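(* Let $\{c_n\}$ and $(S,<)$ be as in the context, and let $M$ be a nonempty subset of $S$. If $M$ is bounded from above (resp. below) with respect to $<$, then $M$ has a supremum (resp. an infimum) in $(S,<)$.
   Context: $\{c_n\}_{n\ge1}$ is a sequence of positive integers with $c_n\mid c_{n+1}$ for all $n$. $S$ is the set of sequences $(q_n)_{n\ge0}$ of rationals such that: $q_0\in\mathbb{Z}$; $q_n\le1$ for $n\ge1$; if $q_1=1$ then $q_2\ne0$; if $q_m=0$ for some $m\ge1$ then $q_n=0$ for all $n\ge m$; there is a sequence of positive integers $\{a_n\}$ with $a_{n+1}\ge\frac{c_{n+1}}{c_n}a_n(a_n+1)$ for all $n\ge1$ and $q_n=c_n/a_n$ whenever $n\ge1$, $q_n\ne0$; and for each $n\ge1$, if $q_{n+1}\ne0$ then $q_{n+2}\ne0$ or $a_{n+1}>\frac{c_{n+1}}{c_n}a_n(a_n+1)$. For distinct $P=(p_n),Q=(q_n)\in S$, with $i$ the least index with $p_i\ne q_i$: $P<Q$ iff $p_0<q_0$ when $i=0$, $p_i<q_i$ when $i$ is odd, $p_i>q_i$ when $i\ge2$ is even. *)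

(* Defs.v *)
From HB Require Import structures.
From mathcomp Require Import all_boot all_order all_algebra.
From mathcomp Require Import boolp classical_sets.

Set Implicit Arguments.
Unset Strict Implicit.
Unset Printing Implicit Defensive.

Import Order.TTheory GRing.Theory Num.Theory.
Local Open Scope classical_set_scope.
Local Open Scope ring_scope.

(* The sequences c and a are indexed from 1; their values at 0 are junk and
   never constrained.  [c n.+1 %/ c n] is exact when c n %| c n.+1. *)
Definition growth_bound (c a : nat -> nat) (n : nat) : nat :=
  (c n.+1 %/ c n * (a n * (a n).+1))%N.

(* The same witness a serves in all four clauses of the existential. *)
Definition seqS (c : nat -> nat) : set (nat -> rat) :=
  [set q : nat -> rat |
    [/\ q 0%N \is a Num.int,
        forall n, (1 <= n)%N -> q n <= 1,
        q 1%N = 1 -> q 2%N <> 0,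
        forall m, (1 <= m)%N -> q m = 0 -> forall n, (m <= n)%N -> q n = 0
      & exists a : nat -> nat,
        [/\ forall n, (1 <= n)%N -> (0 < a n)%N,
            forall n, (1 <= n)%N -> (growth_bound c a n <= a n.+1)%N,
            forall n, (1 <= n)%N -> q n <> 0 -> q n = (c n)%:R / (a n)%:R
          & forall n, (1 <= n)%N -> q n.+1 <> 0 ->
              q n.+2 <> 0 \/ (growth_bound c a n < a n.+1)%N]]].

Definition first_diff (p q : nat -> rat) (i : nat) : Prop :=
  (forall j, (j < i)%N -> p j = q j) /\ p i <> q i.

Definition slt (p q : nat -> rat) : Prop :=
  exists2 i, first_diff p q i &
    if (i == 0)%N || odd i then p i < q i else q i < p i.

Definition sle (p q : nat -> rat) : Prop := p = q \/ slt p q.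

Definition is_upper_bound (c : nat -> nat) (M : set (nat -> rat))
    (u : nat -> rat) : Prop :=
  seqS c u /\ forall p, M p -> sle p u.

Definition is_lower_bound (c : nat -> nat) (M : set (nat -> rat))
    (l : nat -> rat) : Prop :=
  seqS c l /\ forall p, M p -> sle l p.

Definition is_supremum (c : nat -> nat) (M : set (nat -> rat))
    (s : nat -> rat) : Prop :=
  is_upper_bound c M s /\ forall u, is_upper_bound c M u -> sle s u.

Definition is_infimum (c : nat -> nat) (M : set (nat -> rat))
    (s : nat -> rat) : Prop :=
  is_lower_bound c M s /\ forall l, is_lower_bound c M l -> sle l s.

(* Main.v *)
Require Import Defs.
From HB Require Import structures.
From mathcomp Require Import all_boot all_order all_algebra.
From mathcomp Require Import boolp classical_sets.
From mathcomp Require Import zify lra.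

(** Infima are suprema of sets of lower bounds, so only suprema need work.
The order is an alternating lexicographic one; build [s] greedily, taking at
each coordinate the best value occurring in [M] among the members that agree
with [s] so far.  If the best value is always attained, [s] belongs to [S],
whose conditions only involve three consecutive coordinates, and is the
supremum.  Otherwise the first failure occurs at an even index [n >= 2], where
the denominators are unbounded, and the natural candidate is [s] cut off at
[n].  The cut-off sequence may violate one of the termination conditions
defining [S]; it then has an immediate successor in [S], obtained by carrying
into coordinate [n - 2], and this successor is the supremum. *)

Set Implicit Arguments.
Unset Strict Implicit.
Unset Printing Implicit Defensive.

Import Order.TTheory GRing.Theory Num.Theory.
Local Open Scope classical_set_scope.
Local Open Scope ring_scope.

(** * The alternating lexicographic order as a strict total order *)

Definition agree (n : nat) (p q : nat -> rat) : Prop :=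
  forall j, (j < n)%N -> p j = q j.

Definition coord_lt (i : nat) (x y : rat) : Prop :=
  if (i == 0)%N || odd i then x < y else y < x.

Lemma agree_sym n p q : agree n p q -> agree n q p.
Proof. by move=> h j /h. Qed.

Lemma agree_trans n p q r : agree n p q -> agree n q r -> agree n p r.
Proof. by move=> h k j jn; rewrite h // k. Qed.

Lemma agree_le m n p q : agree n p q -> (m <= n)%N -> agree m p q.
Proof. by move=> h mn j jm; apply: h; apply: leq_trans mn. Qed.

Lemma agreeS n p q : agree n p q -> p n = q n -> agree n.+1 p q.
Proof.
by move=> h e j; rewrite ltnS leq_eqVlt => /orP[/eqP -> //|/h].
Qed.

Lemma coord_lt_irr i x : ~ coord_lt i x x.
Proof. by rewrite /coord_lt; case: ifP => _; rewrite ltxx. Qed.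

Lemma coord_lt_trans i x y z :
  coord_lt i x y -> coord_lt i y z -> coord_lt i x z.
Proof.
rewrite /coord_lt; case: ifP => _ h k; first exact: lt_trans h k.
exact: lt_trans k h.
Qed.

Lemma coord_lt_total i x y : x <> y -> coord_lt i x y \/ coord_lt i y x.
Proof.
rewrite /coord_lt => /eqP; rewrite neq_lt => /orP[] h; case: ifP => _; by [left|right].
Qed.

Lemma coord_lt_even i x y : (0 < i)%N -> ~~ odd i -> coord_lt i x y = (y < x).
Proof. by rewrite /coord_lt => /prednK <- /negbTE ->. Qed.

Lemma coord_lt_odd i x y : odd i -> coord_lt i x y = (x < y).
Proof. by rewrite /coord_lt => ->; rewrite orbT. Qed.

(** Irreflexivity of [coord_lt i] supplies the disequality that [first_diff] asks for. *)
Lemma slt_at i p q : agree i p q -> coord_lt i (p i) (q i) -> slt p q.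
Proof.
move=> h k; exists i => //; split => // e; rewrite e in k.
exact: coord_lt_irr k.
Qed.

Lemma sltE p q : slt p q -> exists2 i, agree i p q & coord_lt i (p i) (q i).
Proof. by case=> i [h _] k; exists i. Qed.

Lemma slt_irr p : ~ slt p p.
Proof. by move=> /sltE[i _ /coord_lt_irr]. Qed.

Lemma slt_trans p q r : slt p q -> slt q r -> slt p r.
Proof.
move=> /sltE[i hi ki] /sltE[j hj kj]; case: (ltngtP i j) => ij.
- apply: (@slt_at i); last by rewrite -hj.
  by apply: agree_trans hi _; exact: (agree_le hj (ltnW ij)).
- apply: (@slt_at j); last by rewrite hi.
  by apply: agree_trans _ hj; exact: (agree_le hi (ltnW ij)).
- subst j; apply: (@slt_at i); first exact: agree_trans hi hj.
  exact: coord_lt_trans ki kj.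
Qed.

Lemma slt_total p q : p <> q -> slt p q \/ slt q p.
Proof.
move=> pq; have ex : exists j, p j != q j.
  by apply: contrapT => h; apply: pq; apply/funext => j; apply: contrapT => /eqP k;
    apply: h; exists j.
have [i /eqP ne mini] := ex_minnP ex.
have h : agree i p q.
  by move=> j ji; apply: contrapT => /eqP /mini; rewrite leqNgt ji.
case: (coord_lt_total i ne) => k; [left|right]; first exact: slt_at k.
by apply: slt_at k; apply: agree_sym.
Qed.

Lemma sle_or_slt p q : sle p q \/ slt q p.
Proof.
have [->|/slt_total[]] := pselect (p = q); first by left; left.
- by left; right.
- by right.
Qed.

Lemma sle_slt_false p q : sle p q -> slt q p -> False.
Proof.
case=> [->|h k]; first exact: slt_irr.
exact: (slt_irr (slt_trans h k)).
Qed.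

(** * Denominators and the local form of membership in [seqS c] *)

Section Expansions.
Variable c : nat -> nat.
Hypothesis c_gt0 : forall n, (1 <= n)%N -> (0 < c n)%N.

(** Recovers the denominator from the value, so that no witness [a] has to be carried along; it is 0
    where [q n = 0]. *)
Definition den (q : nat -> rat) (n : nat) : nat := Num.truncn ((c n)%:R / q n).

Lemma den_frac q n a : (1 <= n)%N -> (0 < a)%N -> q n = (c n)%:R / a%:R ->
  den q n = a.
Proof.
move=> n1 a0 e; rewrite /den e invf_div mulrCA divff ?mulr1 ?natrK //.
by rewrite pnatr_eq0 -lt0n c_gt0.
Qed.

Lemma frac_lt n a b : (1 <= n)%N -> (0 < a)%N -> (0 < b)%N ->
  ((c n)%:R / a%:R < (c n)%:R / b%:R :> rat) = (b < a)%N.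
Proof.
move=> n1 a0 b0; rewrite ltr_pM2l ?ltr0n ?c_gt0 //.
by rewrite ltf_pV2 ?posrE ?ltr0n // ltr_nat.
Qed.

(* Every clause is local: it only looks at three consecutive coordinates. *)
Lemma seqSP q : seqS c q <->
  [/\ q 0%N \is a Num.int,
      forall n, (1 <= n)%N -> q n <= 1,
      q 1%N = 1 -> q 2%N <> 0,
      forall n, (1 <= n)%N -> q n = 0 -> q n.+1 = 0
    & (forall n, (1 <= n)%N -> q n <> 0 ->
        (0 < den q n)%N /\ q n = (c n)%:R / (den q n)%:R) /\
      forall n, (1 <= n)%N -> q n.+1 <> 0 ->
        (growth_bound c (den q) n <= den q n.+1)%N /\
        (q n.+2 <> 0 \/ (growth_bound c (den q) n < den q n.+1)%N)].
Proof.
split.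
  case=> q0 q1 q12 qz [a [a0 ag aq as_]].
  have E n : (1 <= n)%N -> q n <> 0 -> den q n = a n.
    by move=> n1 qn; apply: den_frac; [|exact: a0|exact: aq].
  split=> //; first by move=> n n1 qn; apply: (qz n).
  split=> n n1 qn; first by rewrite E //; split; [exact: a0|exact: aq].
  have qn0 : q n <> 0 by move=> h; apply: qn; apply: (qz n).
  rewrite /growth_bound !E //; split; first exact: ag.
  exact: as_.
case=> q0 q1 q12 qz [qd qg]; split=> //.
  move=> m m1 qm n; elim: n => [|n IH]; first by rewrite leqn0 => /eqP m0; rewrite m0 in m1.
  rewrite leq_eqVlt => /orP[/eqP <- //|]; rewrite ltnS => mn.
  by apply: qz; [exact: leq_trans mn|exact: IH].
(* Where [q] vanishes, [a] is free: the growth bound itself is taken, raised to 1 to stay positive.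
   The value at 0 is junk. *)
pose fix a n := if n is m.+1 then
    if q m.+1 == 0 then maxn 1 (c m.+1 %/ c m * (a m * (a m).+1)) else den q m.+1
  else 1%N.
have aE n : (1 <= n)%N -> q n <> 0 -> a n = den q n.
  by case: n => // n _ /eqP /negbTE /= ->.
have aS n : (1 <= n)%N -> q n.+1 <> 0 -> growth_bound c a n = growth_bound c (den q) n.
  move=> n1 qn; rewrite /growth_bound aE // => h; apply: qn; exact: qz.
exists a; split.
- case=> // n _ /=; case: eqP => qn; first by rewrite leq_maxl.
  by have [] := qd n.+1 isT qn.
- move=> n n1; have [qn|qn] := pselect (q n.+1 = 0).
    by rewrite /= qn eqxx leq_maxr.
  by rewrite aS // aE //; have [] := qg n n1 qn.
- by move=> n n1 qn; rewrite aE //; have [] := qd n n1 qn.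
- by move=> n n1 qn; rewrite aS // aE //; have [] := qg n n1 qn.
Qed.

Lemma seqS_frac q n : seqS c q -> (1 <= n)%N -> q n <> 0 ->
  (0 < den q n)%N /\ q n = (c n)%:R / (den q n)%:R.
Proof. by move=> /seqSP[_ _ _ _ [h _]]; apply: h. Qed.

Lemma seqS_ge0 q n : seqS c q -> (1 <= n)%N -> 0 <= q n.
Proof.
move=> Sq n1; have [->//|/(seqS_frac Sq n1)[_ ->]] := pselect (q n = 0).
by rewrite divr_ge0.
Qed.

Lemma seqS_zero q m n : seqS c q -> (1 <= m)%N -> (m <= n)%N -> q m = 0 ->
  q n = 0.
Proof. by case=> _ _ _ h _ m1 mn qm; apply: (h m). Qed.

(** Each clause at [n] reads coordinates up to [n.+2] at most, so it can be transported from a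
    member of [seqS c] sharing a prefix of length [n.+3]. *)
Lemma seqS_closed s :
  (forall n, exists2 p, seqS c p & agree n p s) -> seqS c s.
Proof.
move=> H; apply/seqSP.
have D n p j : agree n p s -> (j < n)%N -> den s j = den p j.
  by move=> h jn; rewrite /den h.
split.
- have [p [p0 _ _ _ _] h] := H 1%N; by rewrite -h.
- move=> n n1; have [p [_ p1 _ _ _] h] := H n.+1; rewrite -h //; exact: p1.
- have [p [_ _ p1 _ _] h] := H 3%N; by rewrite -!h.
- move=> n n1; have [p /seqSP[_ _ _ pz _] h] := H n.+2.
  by rewrite -!h //; apply: pz.
split=> n n1.
- have [p /seqSP[_ _ _ _ [pz _]] h] := H n.+1.
  by rewrite (D _ _ _ h) // -!h //; apply: pz.
- have [p /seqSP[_ _ _ _ [_ pz]] h] := H n.+3.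
  have [h0 h1 h2] : [/\ p n = s n, p n.+1 = s n.+1 & p n.+2 = s n.+2].
    by split; apply: h; lia.
  by rewrite /growth_bound /den -h0 -h1 -h2; apply: pz.
Qed.

(** * Truncated sequences and their immediate successors *)

Definition truncate (n : nat) (q : nat -> rat) : nat -> rat :=
  fun j => if (j < n)%N then q j else 0.

Lemma truncate_agree n q : agree n (truncate n q) q.
Proof. by move=> j jn; rewrite /truncate jn. Qed.

Lemma truncate_ge n q j : (n <= j)%N -> truncate n q j = 0.
Proof. by rewrite /truncate leqNgt => /negbTE ->. Qed.

(* Applied with [x = c k / (a k).+1], reflecting the carry
   [c/a - c/(a * (a + 1)) = c/(a + 1)], and with [x = q 0 + 1] when [k = 0]. *)
Definition bump (k : nat) (x : rat) (q : nat -> rat) : nat -> rat :=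
  fun j => if (j == k)%N then x else truncate k q j.

Lemma bump_agree k x q : agree k (bump k x q) q.
Proof. by move=> j jk; rewrite /bump ltn_eqF // truncate_agree. Qed.

Lemma bump_at k x q : bump k x q k = x.
Proof. by rewrite /bump eqxx. Qed.

Lemma bump_gt k x q j : (k < j)%N -> bump k x q j = 0.
Proof. by move=> kj; rewrite /bump gtn_eqF // truncate_ge // ltnW. Qed.

(** A sequence [u] above [t] cannot first differ from it after [k]: at [k.+1] it would exceed the
    maximum given by the last hypothesis, at [k.+2] it would be negative, and later both vanish. So
    it departs at [k] or before, and at [k] the value [x] is the least possible increase. *)
Lemma bump_succ k x t : ~~ odd k ->
  (forall j, (k.+2 <= j)%N -> t j = 0) ->
  coord_lt k (t k) x ->
  (forall u, seqS c u -> agree k u t -> coord_lt k (t k) (u k) ->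
     x = u k \/ coord_lt k x (u k)) ->
  (forall u, seqS c u -> agree k.+1 u t -> u k.+1 <= t k.+1) ->
  slt t (bump k x t) /\
  forall u, seqS c u -> slt t u -> sle (bump k x t) u.
Proof.
move=> ek tz tx H1 H2; split.
  apply: (@slt_at k); last by rewrite bump_at.
  by apply: agree_sym; apply: bump_agree.
move=> u Su /sltE[i ag lt_i]; case: (ltngtP i k) => ik.
- right; apply: (@slt_at i); last by rewrite bump_agree.
  by apply: agree_trans ag; exact: (agree_le (@bump_agree k x t) (ltnW ik)).
- move: ik; rewrite leq_eqVlt => /orP[/eqP ik|ik].
    subst i; move: lt_i; rewrite coord_lt_odd //= ltNge H2 //.
    exact: agree_sym.
  have := lt_i; rewrite tz //; move: ik; rewrite leq_eqVlt => /orP[/eqP ik|ik].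
    subst i; rewrite coord_lt_even //= ?negbK // ltNge seqS_ge0 //.
  have uk : u k.+2 = 0 by rewrite -ag // tz.
  rewrite (seqS_zero Su _ _ uk) //; last exact: ltnW.
  by move/coord_lt_irr.
subst i; have bu : agree k (bump k x t) u.
  exact: agree_trans (@bump_agree _ _ _) ag.
have [xu|xu] := H1 u Su (agree_sym ag) lt_i; last first.
  by right; apply: slt_at bu _; rewrite bump_at.
(* Zeros are the smallest continuation after [x], since [k.+1] is odd and coordinates of [u] are
   nonnegative there. *)
have [u0|u0] := pselect (u k.+1 = 0).
  left; apply/funext => j; case: (ltngtP j k) => jk.
  - exact: bu.
  - by rewrite bump_gt // (seqS_zero Su _ jk u0).
  - by rewrite jk bump_at.
right; apply: (@slt_at k.+1).
  by apply: agreeS bu _; rewrite bump_at.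
rewrite coord_lt_odd // bump_gt // lt_def seqS_ge0 // andbT.
exact/eqP.
Qed.

(** Cutting can only break a clause that needs a nonzero coordinate at [n]: the one on coordinates 1
    and 2, or the alternative to a strict growth bound at the last kept coordinate [n - 1]. *)
Lemma truncate_notin n w : seqS c w -> (0 < n)%N -> ~~ odd n ->
  (forall j, (0 < j < n)%N -> w j <> 0) -> ~ seqS c (truncate n w) ->
  (n = 2%N /\ w 1%N = 1) \/
  exists2 k, n = k.+2 &
    (0 < k)%N /\ den w k.+1 = growth_bound c (den w) k.
Proof.
move=> /seqSP[w0 w1 w12 wz [wd wg]] n0 en wn0 nS.
apply: contrapT => /not_orP[N1 N2]; apply: nS; apply/seqSP.
have D j : (j < n)%N -> den (truncate n w) j = den w j.
  by move=> jn; rewrite /den truncate_agree.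
split.
- by rewrite truncate_agree.
- by move=> j j1; rewrite /truncate; case: ifP => // _; apply: w1.
- case: (ltngtP n 2) => n2; first by case: (n) n0 en n2 => [|[|]].
    by rewrite !truncate_agree //; apply: ltnW.
  by rewrite truncate_agree ?n2 // => h; case: N1.
- move=> j j1; case: (ltnP j.+1 n) => jn.
    by rewrite !truncate_agree ?(ltnW jn) //; apply: wz.
  by rewrite (truncate_ge _ jn).
split=> j j1.
- case: (ltnP j n) => jn; last by rewrite truncate_ge.
  by rewrite D // !truncate_agree //; apply: wd.
- case: (ltnP j.+1 n) => jn; last by rewrite truncate_ge.
  rewrite /growth_bound !D // ?(ltnW jn) // truncate_agree // => wj.
  have [g1 g2] := wg j j1 wj; split=> //.
  case: (ltnP j.+2 n) => jn2; first by rewrite truncate_agree.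
  right; rewrite ltn_neqAle g1 andbT; apply/negP => /eqP g.
  apply: N2; exists j => //; apply/eqP; by rewrite eqn_leq jn jn2.
Qed.

(** Each failure yields a carry: a prefix [w 0, 1] becomes [w 0 + 1], and a tight last denominator
    raises the denominator at [k] by one. Zeros follow in both cases. *)
Lemma truncate_succ n w : seqS c w -> (0 < n)%N -> ~~ odd n ->
  (forall j, (0 < j < n)%N -> w j <> 0) -> ~ seqS c (truncate n w) ->
  exists t', [/\ seqS c t', slt (truncate n w) t' &
    forall u, seqS c u -> slt (truncate n w) u -> sle t' u].
Proof.
move=> Sw n0 en wn0 nS; set t := truncate n w.
have [[n2 w1]|[k nk [k0 dk]]] := truncate_notin Sw n0 en wn0 nS.
- exists (bump 0 (t 0%N + 1) t).
  have [w0 _ _ _ _] := Sw.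
  have t0 : t 0%N \is a Num.int by rewrite /t truncate_agree.
  have b0 j : (0 < j)%N -> bump 0 (t 0%N + 1) t j = 0.
    by move=> j0; rewrite bump_gt.
  have [|//||||h1 h2] := @bump_succ 0 (t 0%N + 1) t; first by [].
  + by move=> j j2; rewrite /t truncate_ge // n2.
  + by rewrite /coord_lt /= ltrDl.
  + move=> u [u0 _ _ _ _] _; rewrite /coord_lt /= => tu.
    have : t 0%N + 1 <= u 0%N.
      move: t0 u0 tu => /intrP[x ->] /intrP[y ->].
      by rewrite -(intrD _ x 1) ltr_int ler_int; lia.
    by rewrite le_eqVlt => /orP[/eqP|]; [left|right].
  + move=> u [_ u1 _ _ _] _.
    by rewrite /t truncate_agree ?n2 // w1; apply: u1.
  split=> //; apply/seqSP; split.
  + by rewrite bump_at rpredD.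
  + by move=> j j1; rewrite b0.
  + by rewrite b0 // => /eqP; rewrite eq_sym oner_eq0.
  + by move=> j j1 _; rewrite b0.
  + by split=> j j1; rewrite b0.
subst n; pose a := den w k.
have ek : ~~ odd k by move: en; rewrite /= negbK.
(* Being even and positive, [k] is at least 2, so the bumped sequence is nonzero at 2, as the clause
   on coordinates 1 and 2 may require. *)
have k2 : (1 < k)%N by case: (k) k0 ek => [|[|]].
have [a0 wk] : (0 < a)%N /\ w k = (c k)%:R / a%:R.
  by apply: seqS_frac => //; apply: wn0; rewrite k0 ltnW.
have [b0 wk1] : (0 < den w k.+1)%N /\ w k.+1 = (c k.+1)%:R / (den w k.+1)%:R.
  by apply: seqS_frac => //; apply: wn0 => /=.
(* Denominators are integers, so this is the first admissible value below [w k]. *)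
pose x : rat := (c k)%:R / (a.+1)%:R.
have xk : x < w k by rewrite wk frac_lt.
have x0 : 0 < x by rewrite divr_gt0 // ltr0n c_gt0.
have tk : t k = w k by rewrite /t truncate_agree.
have tk1 : t k.+1 = w k.+1 by rewrite /t truncate_agree.
have bw : agree k (bump k x t) w.
  apply: agree_trans (@bump_agree _ _ _) _.
  exact: (agree_le (@truncate_agree _ _) (leqW (leqnSn k))).
have [|||||h1 h2] := @bump_succ k x t => //.
- by move=> j kj; rewrite /t truncate_ge.
- by rewrite coord_lt_even // tk.
- move=> u Su _; rewrite !coord_lt_even // tk => uk.
  have [u0|u0] := pselect (u k = 0); first by right; rewrite u0.
  have [d0 dE] := seqS_frac Su k0 u0.
  move: uk; rewrite dE wk frac_lt // => ad.
  rewrite /x; case: (ltngtP a.+1 (den u k)) => e.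
  + by right; rewrite frac_lt.
  + by move: e; rewrite ltnS leqNgt ad.
  + by left; rewrite e.
(* Equality in the growth bound makes [den w k.+1] the least denominator allowed after [a], hence
   [w k.+1] the largest value. *)
- move=> u Su ag; rewrite tk1.
  have [u0|u0] := pselect (u k.+1 = 0).
    by rewrite u0; apply: seqS_ge0.
  have [d0 dE] := seqS_frac Su (ltn0Sn k) u0.
  rewrite dE wk1 leNgt frac_lt // -leqNgt dk.
  have /seqSP[_ _ _ _ [_ ug]] := Su; have [g _] := ug k k0 u0.
  by move: g; rewrite /growth_bound /den ag // tk.
exists (bump k x t); split=> //; apply/seqSP.
have [w0 w1 w12 wz [wd wg]] := (seqSP w).1 Sw.
have Dk : den (bump k x t) k = a.+1 by apply: den_frac => //; rewrite bump_at.
have D j : (j < k)%N -> den (bump k x t) j = den w j.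
  by move=> jk; rewrite /den bw.
have n0k j : (0 < j <= k)%N -> bump k x t j <> 0.
  move=> /andP[j0]; rewrite leq_eqVlt => /orP[/eqP ->|jk].
    by rewrite bump_at; apply/eqP; rewrite gt_eqF.
  by rewrite bw //; apply: wn0; rewrite j0 ltnW // ltnW.
split.
- by rewrite bw.
- move=> j j1; case: (ltngtP j k) => jk; first by rewrite bw //; apply: w1.
    by rewrite bump_gt.
  by rewrite jk bump_at (le_trans (ltW xk)) // w1.
- by move=> _; apply: n0k.
- move=> j j1; case: (leqP j k) => jk; first by move/n0k; rewrite j1 jk => /(_ isT).
  by move=> _; rewrite bump_gt // leqW.
split=> j j1.
- case: (ltngtP j k) => jk.
  + by rewrite bw // D //; apply: wd.
  + by rewrite bump_gt.
  + by rewrite jk Dk bump_at.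
- case: (ltngtP j.+1 k) => jk.
  + rewrite /growth_bound bw // !D // ?(ltnW jk) // => wj.
    have [g _] := wg j j1 wj; split=> //; left; apply: n0k => //.
  + by rewrite bump_gt.
  (* The bumped sequence stops at [k], so strict growth is required there; passing from [a] to
     [a.+1] provides it. *)
  + move=> _; rewrite /growth_bound jk Dk D -?jk //.
    have wj : w j.+1 <> 0 by apply: wn0; rewrite /= jk ltnW.
    have [g _] := wg j j1 wj.
    have g' : (c j.+1 %/ c j * (den w j * (den w j).+1) < a.+1)%N by rewrite ltnS /a -jk.
    by split; [exact: ltnW|right].
Qed.

End Expansions.

(** * Greedy choice of coordinates within [M] *)

Definition best_at (M : set (nat -> rat)) (n : nat) (w p : nat -> rat) : Prop :=
  [/\ M p, agree n p w & forall q, M q -> agree n q w -> ~ coord_lt n (p n) (q n)].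

Lemma best_at_agree M n w w' p : agree n w w' -> best_at M n w p -> best_at M n w' p.
Proof.
move=> ww [Mp pw h]; split=> //; first exact: agree_trans pw ww.
by move=> q Mq qw; apply: h => //; apply: agree_trans qw (agree_sym ww).
Qed.

(* [m n] is a member of [M] realizing the first [n.+1] coordinates of [s]. *)
Lemma greedy (M : set (nat -> rat)) : M !=set0 ->
  exists s m, [/\ forall n, M (m n), forall n, agree n.+1 (m n) s &
    forall n, (exists p, best_at M n s p) -> best_at M n s (m n)].
Proof.
case=> p0 Mp0.
(* Without a best member the current one is kept, so the chain never leaves [M]. *)
pose next n w := if pselect (exists p, best_at M n w p) is left h
  then projT1 (cid h) else w.
have nextM n w : M w -> M (next n w).
  by move=> Mw; rewrite /next; case: pselect => // h; case: cid => ? [].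
have nextA n w : agree n (next n w) w.
  by rewrite /next; case: pselect => // h; case: cid => ? [].
have nextB n w : (exists p, best_at M n w p) -> best_at M n w (next n w).
  by rewrite /next; case: pselect => // h _; case: cid.
pose fix m n := if n is k.+1 then next n (m k) else next 0%N p0.
have mM n : M (m n) by elim: n => [|n IH]; apply: nextM.
have mA k n : (n <= k)%N -> agree n.+1 (m k) (m n).
  elim: k => [|k IH]; first by rewrite leqn0 => /eqP ->.
  rewrite leq_eqVlt => /orP[/eqP -> //|]; rewrite ltnS => nk.
  by apply: agree_trans (IH nk); exact: (agree_le (@nextA k.+1 (m k))).
have mS n : agree n.+1 (m n) (fun j => m j j).
  (* Coordinate [j] is frozen from stage [j] on, so the diagonal is the limit of the chain. *)
  by move=> j; rewrite ltnS => jn; apply: mA.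
exists (fun j => m j j), m; split=> // -[|n] [p bp].
  by apply: (@best_at_agree _ _ p0) => //; apply: nextB; exists p; apply: best_at_agree bp.
apply: (best_at_agree (mS n)); apply: nextB; exists p.
by apply: best_at_agree bp; apply: agree_sym.
Qed.

(** * Attainment of the best value by parity of the index, and existence of suprema *)

Section Supremum.
Variables (c : nat -> nat) (M : set (nat -> rat)).
Hypothesis c_gt0 : forall n, (1 <= n)%N -> (0 < c n)%N.
Hypothesis M_sub : M `<=` seqS c.

Lemma not_best n w : ~ (exists p, best_at M n w p) ->
  forall p, M p -> agree n p w ->
  exists q, [/\ M q, agree n q w & coord_lt n (p n) (q n)].
Proof.
move=> nb p Mp pw; apply: contrapT => h; apply: nb; exists p; split=> // q Mq qw k.
by apply: h; exists q.
Qed.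

Lemma best_at0 w u : M w -> is_upper_bound c M u -> exists p, best_at M 0 w p.
Proof.
move=> Mw [_ ub]; apply: contrapT => /not_best nb.
(* Coordinate 0 is an integer, so each improvement lowers the gap to [u 0] by at least 1; [k] bounds
   the gap. *)
suff H k p : M p -> u 0%N - p 0%N < k%:R -> False.
  exact: H Mw (truncnS_gt _).
elim: k p => [|k IH] p Mp; first rewrite subr_lt0 => up.
  by apply: (sle_slt_false (ub p Mp)); apply: (@slt_at 0).
have [//|q [Mq _ pq]] := nb p Mp.
move=> h; apply: (IH q Mq); move: h pq; rewrite /coord_lt /=.
have [p0 _ _ _ _] := M_sub Mp; have [q0 _ _ _ _] := M_sub Mq.
move: p0 q0 => /intrP[x ->] /intrP[y ->]; rewrite ltr_int -natr1 => h xy.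
have : (x + 1)%:~R <= y%:~R :> rat by rewrite ler_int; lia.
rewrite intrD; lra.
Qed.

(** At an odd index improving means a strictly smaller denominator, which cannot go on forever. One
    improvement already makes the value nonzero, so that it has a denominator. *)
Lemma best_at_odd n w : odd n -> M w -> exists p, best_at M n w p.
Proof.
move=> on Mw; apply: contrapT => /not_best nb.
have n1 : (1 <= n)%N by case: (n) on.
have up p : M p -> agree n p w -> exists q, [/\ M q, agree n q w, q n <> 0 & p n < q n].
  move=> Mp pw; have [q [Mq qw]] := nb p Mp pw; rewrite coord_lt_odd // => pq.
  exists q; split=> // q0; move: pq; rewrite q0 ltNge.
  by rewrite (seqS_ge0 c_gt0 (M_sub Mp) n1).
suff H k p : M p -> agree n p w -> p n <> 0 -> (den c p n <= k)%N -> False.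
  by have [//|q [Mq qw q0 _]] := up w Mw; apply: H Mq qw q0 (leqnn _).
elim: k p => [|k IH] p Mp pw p0; have [d0 dE] := seqS_frac c_gt0 (M_sub Mp) n1 p0.
  by rewrite leqn0 => /eqP d; rewrite d in d0.
move=> dk; have [q [Mq qw q0 pq]] := up p Mp pw; apply: (IH q) => //.
have [e0 eE] := seqS_frac c_gt0 (M_sub Mq) n1 q0.
by move: pq; rewrite dE eE frac_lt // => ed; rewrite -ltnS (leq_trans ed).
Qed.

(** At an even index improving means a strictly larger denominator, so endless improvement makes the
    denominators unbounded. *)
Lemma not_best_even n w : (0 < n)%N -> ~~ odd n -> M w ->
  ~ (exists p, best_at M n w p) ->
  forall k, exists p, [/\ M p, agree n p w, p n <> 0 & (k <= den c p n)%N].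
Proof.
move=> n1 en Mw /not_best nb.
have dn p : M p -> agree n p w ->
    exists q, [/\ M q, agree n q w, p n <> 0, q n <> 0 & q n < p n].
  move=> Mp pw; have [q [Mq qw]] := nb p Mp pw; rewrite coord_lt_even // => pq.
  (* A second improvement [r] forces [q n > r n >= 0], so [q n] has a denominator too. *)
  have [r [Mr rw]] := nb q Mq qw; rewrite coord_lt_even // => qr.
  have r0 := seqS_ge0 c_gt0 (M_sub Mr) n1.
  exists q; split=> //; apply/eqP; rewrite gt_eqF //; last exact: le_lt_trans qr.
  exact: lt_trans (le_lt_trans r0 qr) pq.
elim=> [|k [p [Mp pw p0 kp]]]; first by exists w; have [//|q []] := dn w Mw.
have [q [Mq qw _ q0 qp]] := dn p Mp pw; exists q; split=> //.
have [e0 eE] := seqS_frac c_gt0 (M_sub Mq) n1 q0.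
have [d0 dE] := seqS_frac c_gt0 (M_sub Mp) n1 p0.
by move: qp; rewrite dE eE frac_lt //; apply: leq_ltn_trans.
Qed.

Lemma upper_bound_coord u p i : is_upper_bound c M u -> M p -> agree i u p ->
  ~ coord_lt i (u i) (p i).
Proof. by move=> [_ ub] Mp up k; apply: (sle_slt_false (ub p Mp)); apply: slt_at k. Qed.

Lemma supremum_exists : M !=set0 -> (exists u, is_upper_bound c M u) ->
  exists s, is_supremum c M s.
Proof.
move=> /greedy[s [m [mM mA mB]]] [u0 ub0].
(* [m i] lies in [M] and shares coordinate [i] and all earlier ones with [s]. *)
have le_prefix u i : is_upper_bound c M u -> agree i u s ->
    ~ coord_lt i (u i) (s i).
  move=> ub us; rewrite -(mA i i) //; apply: upper_bound_coord => //.
  by apply: agree_trans us _; apply: agree_sym; exact: (agree_le (mA i) (leqnSn i)).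
have [all_best|] := pselect (forall n, exists p, best_at M n s p).
  exists s; split; first split.
  - apply: seqS_closed => // n; exists (m n); first exact: M_sub.
    exact: (agree_le (mA n) (leqnSn n)).
  - move=> p Mp; have [//|/sltE[i sp k]] := sle_or_slt p s.
    have [_ _ h] := mB i (all_best i); case: (h p Mp (agree_sym sp)).
    by rewrite mA.
  - move=> u ub; have [//|/sltE[i us k]] := sle_or_slt s u.
    by case: (@le_prefix u i ub).
move=> /existsNP nb0.
have [n /asboolP nb nmin] :=
  ex_minnP (let: ex_intro n h := nb0 in ex_intro _ n (asboolT h)).
have bestn i : (i < n)%N -> exists p, best_at M i s p.
  by move=> i_n; apply: contrapT => /asboolT /nmin; rewrite leqNgt i_n.
have mn : agree n (m n) s := agree_le (mA n) (leqnSn n).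
(* The failure is restated at [m n], which belongs to [M], whereas [s] need not. *)
have nb' : ~ exists p, best_at M n (m n) p.
  by case=> p bp; apply: nb; exists p; apply: best_at_agree bp.
have n0 : (0 < n)%N.
  by rewrite lt0n; apply/eqP => e; apply: nb'; rewrite e; apply: best_at0 ub0.
have en : ~~ odd n by apply/negP => on; apply: nb'; exact: best_at_odd.
have small := not_best_even n0 en (mM n) nb'.
(* A zero before [n] would propagate to coordinate [n] of every member with this prefix, but [small]
   gives one that is nonzero there. *)
have mn0 j : (0 < j < n)%N -> m n j <> 0.
  move=> /andP[j0 jn] mj; have [p [Mp pw pn _]] := small 0%N; apply: pn.
  by apply: (seqS_zero (M_sub Mp) j0 (ltnW jn)); rewrite pw.
pose t := truncate n (m n).
have ts : agree n t s by apply: agree_trans (@truncate_agree _ _) mn.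
have tub p : M p -> sle p t.
  move=> Mp; have [//|/sltE[i tp k]] := sle_or_slt p t.
  have [i_n|n_i] := ltnP i n.
    have si : agree i s p.
      exact: agree_trans (agree_sym (agree_le ts (ltnW i_n))) tp.
    have [_ _ h] := mB i (bestn i i_n); case: (h p Mp (agree_sym si)).
    by rewrite mA // -ts.
  have pt j : (j < i)%N -> p j = t j by move/tp.
  move: n_i; rewrite leq_eqVlt => /orP[/eqP ni|ni].
    have pm : agree n p (m n).
      by rewrite ni; apply: agree_trans (agree_sym tp) _; rewrite -ni; exact: truncate_agree.
    have [q [Mq qw]] := not_best nb' Mp pm.
    rewrite coord_lt_even // => qp; move: k; rewrite -ni coord_lt_even // /t truncate_ge //.
    by rewrite ltNge (seqS_ge0 c_gt0 (M_sub Mp) n0).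
  move: k; rewrite (seqS_zero (M_sub Mp) n0 (ltnW ni)); last by rewrite pt // /t truncate_ge.
  by rewrite /t truncate_ge ?(ltnW ni) // => /coord_lt_irr.
have tle u : is_upper_bound c M u -> sle t u.
  move=> ub; have [//|/sltE[i ut k]] := sle_or_slt t u; have [Su _] := ub.
  case: (ltngtP i n) => i_n.
  - case: (@le_prefix u i ub) => //; last by rewrite -ts.
    exact: agree_trans ut (agree_le ts (ltnW i_n)).
  - move: k; rewrite (seqS_zero Su n0 (ltnW i_n)); last by rewrite ut // /t truncate_ge.
    by rewrite /t truncate_ge ?(ltnW i_n) // => /coord_lt_irr.
  (* Here [u n > 0]; a member of [M] with a larger denominator at [n] then lies above [u]. *)
  - subst i; move: k; rewrite coord_lt_even // /t truncate_ge // => un.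
    have un0 : u n <> 0 by apply/eqP; rewrite gt_eqF.
    have [d0 dE] := seqS_frac c_gt0 Su n0 un0.
    have [p [Mp pw p0 kp]] := small (den c u n).+1.
    have [e0 eE] := seqS_frac c_gt0 (M_sub Mp) n0 p0.
    case: (@upper_bound_coord u p n ub Mp).
      apply: agree_trans ut _; apply: agree_trans (@truncate_agree _ _) _.
      exact: agree_sym.
    by rewrite coord_lt_even // dE eE frac_lt.
(* [t] is below every upper bound and above [M]; if it lies outside [seqS c], its successor takes
   its place. *)
have [St|nSt] := pselect (seqS c t); first by exists t.
have [t' [St' tt' least]] := truncate_succ c_gt0 (M_sub (mM n)) n0 en mn0 nSt.
exists t'; split; first split=> //.
  by move=> p /tub[->|pt]; right => //; apply: slt_trans pt tt'.
move=> u ub; have [Su _] := ub; apply: least => //.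
by have [tu|//] := tle u ub; case: nSt; rewrite tu.
Qed.

End Supremum.

Theorem theorem3p7 (c : nat -> nat)
    (c_gt0 : forall n, (1 <= n)%N -> (0 < c n)%N)
    (c_dvd : forall n, (1 <= n)%N -> (c n %| c n.+1)%N)
    (M : set (nat -> rat)) (M_sub : M `<=` seqS c) (M_neq0 : M !=set0) :
  ((exists u, is_upper_bound c M u) -> exists s, is_supremum c M s) /\
  ((exists l, is_lower_bound c M l) -> exists s, is_infimum c M s).
Proof.
split; first exact: supremum_exists.
move=> [l lb]; have [p Mp] := M_neq0.
(* This bounds the set of lower bounds from above, and also makes its supremum a lower bound of
   [M]. *)
have ub q : M q -> is_upper_bound c (is_lower_bound c M) q.
  by move=> Mq; split; [exact: M_sub|move=> r [_]; apply].
have [||||s [[Ss sub] sleast]] := @supremum_exists c (is_lower_bound c M).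
- exact: c_gt0.
- by move=> r [].
- by exists l.
- by exists p; apply: ub.
by exists s; split=> [|r /sub//]; split=> // q /ub /sleast.
Qed.
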